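(* If $\Delta$ and $\Gamma$ are two non-empty simplicial complexes with disjoint vertex sets, then $$S_{\Delta\cup\Gamma}(t,q)=S_\Delta(t,q)+S_\Gamma(t,q)+(1+t)\bigl(q^{n+m}-(q^n+q^m)\bigr)+t,$$ where $n=f_0(\Delta)$ and $m=f_0(\Gamma)$ are the numbers of $0$-dimensional faces (non-loop vertices) of $\Delta$ and $\Gamma$, respectively.
   Context: A simplicial complex $\Delta$ on a finite vertex set $V$ is a collection of subsets of $V$ (faces) closed under taking subsets. It is non-empty if it has at least one face, in which case the empty set is a face, of dimension $-1$; an element $v\in V$ need not satisfy $\{v\}\in\Delta$ (then $v$ is called a loop). In $\Delta\cup\Gamma$ the empty face is shared. Put $\dim F=|F|-1$. For $i\ge -1$, $C_i(\Delta;\mathbb R)$ is the real vector space of formal linear combinations of oriented $i$-dimensional faces $[F]$, $F\in\Delta$, and $\partial_i\colon C_i\to C_{i-1}$ is the usual signed (augmented) simplicial boundary operator; $\partial_i^*$ is its adjoint (transposed matrix in the natural bases). The Laplacian is $L_i(\Delta)=\partial_{i+1}\partial_{i+1}^*+\partial_i^*\partial_i$, and $\mathbf s_i(\Delta)$ is the multiset of its eigenvalues (non-negative reals). The spectrum polynomial is the generating function $$S_\Delta(t,q)=\sum_{i\ge 0}t^i\sum_{\lambda\in\mathbf s_{i-1}(\Delta)}q^\lambda$$ (exponents of $q$ may be arbitrary non-negative reals). *)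

(* Defs.v *)
From HB Require Import structures.
From mathcomp Require Import all_boot all_order all_algebra.
From mathcomp Require Import polyrcf.
From mathcomp Require Import monalg.
From mathcomp Require Import reals.

Set Implicit Arguments.
Unset Strict Implicit.
Unset Printing Implicit Defensive.

Import Order.TTheory GRing.Theory Num.Theory.
Local Open Scope ring_scope.

Section Complex.
Variable T : finType.
Implicit Types (V F G : {set T}) (D : {set {set T}}) (i j : int).

(* Elements of V need not be faces: loops are allowed. *)
Definition simplicial_complex V D : Prop :=
  (forall F, F \in D -> F \subset V) /\
  (forall F G, F \in D -> G \subset F -> G \in D).

Definition dim F : int := #|F|%:Z - 1.

Definition faces D i : {set {set T}} := [set F in D | dim F == i].

Definition f_num D i : nat := #|faces D i|.

Section Laplacian.
Variable R : nzRingType.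

(* The coefficient of [F] in the boundary of [G], when every face is oriented
   by the enumeration order of T: the sum has at most one term, whose sign is
   given by the position in G of the vertex v being removed. *)
Definition incidence F G : R :=
  \sum_(v in G | G :\ v == F)
     (-1) ^+ #|[set w in G | (enum_rank w < enum_rank v)%N]|.

(* The matrix of C_i -> C_j (acting on columns) in the bases of faces. It is
   used for j = i - 1 only; a separate j avoids casts between the types of
   boundary D i (i + 1) and boundary D (i - 1) i. *)
Definition boundary D j i : 'M[R]_(f_num D j, f_num D i) :=
  \matrix_(a, b) incidence (enum_val a) (enum_val b).

Definition laplacian D i : 'M[R]_(f_num D i) :=
  boundary D i (i + 1) *m (boundary D i (i + 1))^T
  + (boundary D (i - 1) i)^T *m boundary D (i - 1) i.

End Laplacian.
End Complex.

(* The multiset of the eigenvalues of A lying in R, as a sequence in which each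
   one is repeated according to its multiplicity in the characteristic
   polynomial. *)
Definition eigenvalues (R : rcfType) n (A : 'M[R]_n) : seq R :=
  flatten [seq nseq (mup x (char_poly A)) x | x <- rootsR (char_poly A)].

Definition spectrum (R : rcfType) (T : finType) (D : {set {set T}}) (i : int)
  : seq R := eigenvalues (laplacian R D i).

Lemma spectrum_ge0 (R : rcfType) (T : finType) (D : {set {set T}}) (i : int)
  (x : R) : x \in spectrum R D i -> 0 <= x.
Proof.
have sqr_ge0 n (w : 'rV[R]_n) : 0 <= (w *m w^T) 0 0.
  by rewrite mxE sumr_ge0 // => k _; rewrite mxE -expr2 exprn_even_ge0.
case/flatten_mapP=> y yr; rewrite mem_nseq => /andP[_ /eqP ->] {x}.
have p0 : char_poly (laplacian R D i) != 0 by rewrite monic_neq0 ?char_poly_monic.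
have : y \in rootsR (char_poly (laplacian R D i)) by [].
rewrite -(roots_on_rootsR p0) => /andP[_].
rewrite -eigenvalue_root_char => /eigenvalueP[v vL v0].
have vv : 0 < (v *m v^T) 0 0.
  rewrite lt_neqAle sqr_ge0 andbT eq_sym; apply: contra v0.
  rewrite mxE psumr_eq0 => [/allP v0|k _]; last first.
    by rewrite mxE -expr2 exprn_even_ge0.
  apply/eqP/rowP => k; have := v0 k (mem_index_enum _).
  by rewrite !mxE mulf_eq0 orbb => /eqP.
have : 0 <= (v *m laplacian R D i *m v^T) 0 0.
  rewrite /laplacian mulmxDr mulmxDl mxE.
  apply: addr_ge0.
    by have := sqr_ge0 _ (v *m boundary R D i (i + 1)); rewrite trmx_mul !mulmxA.
  have := sqr_ge0 _ (v *m (boundary R D (i - 1) i)^T).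
  by rewrite trmx_mul trmxK !mulmxA.
by rewrite vL -scalemxAl mxE pmulr_lge0.
Qed.

(* The additive monoid of non-negative elements of R, written multiplicatively
   as monalg requires: e stands for q ^ e, and {malg int[exponent R]} is the
   ring of integer combinations of the formal powers q ^ e. *)
Record exponent (R : numDomainType) :=
  Exponent { expval : R; _ : 0 <= expval }.

Section Exponent.
Variable R : numDomainType.

HB.instance Definition _ := [isSub of exponent R for @expval R].
HB.instance Definition _ := [Choice of exponent R by <:].

Definition exponent0 : exponent R := Exponent (lexx 0).

Definition exponentD (e f : exponent R) : exponent R :=
  Exponent (addr_ge0 (valP e) (valP f)).

Fact exponentDA : associative exponentD.
Proof. by move=> e f g; apply: val_inj; apply: addrA. Qed.

Fact exponent0D : left_id exponent0 exponentD.
Proof. by move=> e; apply: val_inj; apply: add0r. Qed.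

Fact exponentD0 : right_id exponent0 exponentD.
Proof. by move=> e; apply: val_inj; apply: addr0. Qed.

Fact exponentD_eq0 e f :
  exponentD e f = exponent0 -> e = exponent0 /\ f = exponent0.
Proof.
move/(congr1 val)/eqP; rewrite /= paddr_eq0 ?(valP e) ?(valP f) //.
by case/andP=> /eqP e0 /eqP f0; split; apply: val_inj.
Qed.

Fact exponentDC : commutative exponentD.
Proof. by move=> e f; apply: val_inj; apply: addrC. Qed.

HB.instance Definition _ := Choice_isMonomialDef.Build (exponent R)
  exponentDA exponent0D exponentD0 exponentD_eq0.
HB.instance Definition _ :=
  MonomialDef_isConomialDef.Build (exponent R) exponentDC.

End Exponent.

(* q ^ x for x >= 0; the value at x < 0 is arbitrary, and is never used in
   spectrum_poly by spectrum_ge0. *)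
Definition qpow (R : numDomainType) (x : R) : {malg int[exponent R]} :=
  << insubd (exponent0 R) x >>.

(* The indeterminate t is 'X. A face has at most #|T| vertices, so that
   spectrum R D (i - 1) is empty for i > #|T|. *)
Definition spectrum_poly (R : rcfType) (T : finType) (D : {set {set T}})
  : {poly {malg int[exponent R]}} :=
  \poly_(i < #|T|.+1) \sum_(x <- spectrum R D (i%:Z - 1)) qpow x.

(* Main.v *)
(** In degree i >= 1 the Laplacian of the union is block diagonal, and in degree
    -1 it is the 1 x 1 matrix (n + m). In degree 0 it is J + L, where J is the
    all-ones matrix and the graph Laplacian L is block diagonal and kills the
    all-ones vector, so that X * chi(J + L) = (X - N) * chi(L) for N vertices.
    Eliminating the graph Laplacians from this identity for the two complexes and
    for their union gives
      chi_union * (X - n) * (X - m) = chi_Delta * chi_Gamma * (X - (n + m)) * X,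
    and multiplicities of roots are additive under products. *)

Require Import Defs.
From HB Require Import structures.
From mathcomp Require Import all_boot all_order all_algebra.
From mathcomp Require Import perm polyrcf.
From mathcomp Require Import monalg.
From mathcomp Require Import reals.

Set Implicit Arguments.
Unset Strict Implicit.
Unset Printing Implicit Defensive.

Import Order.TTheory GRing.Theory Num.Theory.
Local Open Scope ring_scope.

(** * Real roots of polynomials, with multiplicity *)

Section Eigenvalues.
Variable R : rcfType.
Implicit Types p q : {poly R}.

(** The list built in [eigenvalues], but for any polynomial, so that factorisations can be used. *)
Definition roots_mult p : seq R :=
  flatten [seq nseq (mup x p) x | x <- rootsR p].

Lemma count_roots_mult p x : p != 0 -> count_mem x (roots_mult p) = mup x p.
Proof.
move=> p0; rewrite /roots_mult count_flatten -map_comp sumnE big_map.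
transitivity (\sum_(y <- rootsR p | y == x) mup x p)%N.
  rewrite [RHS]big_mkcond; apply: eq_bigr => y _ /=; rewrite count_nseq /=.
  by case: eqP => [->|_]; rewrite ?mul1n ?mul0n.
(* [rootsR] has no repetitions, so the sum is [mup x p] if [x] is a root and 0 otherwise; at a
   non-root [mup x p] is 0 as well. *)
rewrite big_const_seq iter_addn_0 count_uniq_mem ?uniq_roots //.
have <- : root p x = (x \in rootsR p) by rewrite -(roots_on_rootsR p0).
case: (boolP (root p x)) => [_|/negPf px]; rewrite ?muln1 // muln0.
by apply/esym/eqP; rewrite -leqn0 mup_leq // expr1 dvdp_XsubCl px.
Qed.

Lemma roots_multM p q : p != 0 -> q != 0 ->
  perm_eq (roots_mult (p * q)) (roots_mult p ++ roots_mult q).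
Proof.
move=> p0 q0; apply/allP => x _ /=; rewrite count_cat.
by rewrite !count_roots_mult ?mupM ?mulf_neq0.
Qed.

Lemma roots_mult1 : roots_mult 1 = [::].
Proof. by rewrite /roots_mult rootsRC. Qed.

Lemma roots_mult_XsubC c : roots_mult ('X - c%:P) = [:: c].
Proof.
apply: perm_small_eq => //; apply/allP => x _ /=.
rewrite count_roots_mult ?polyXsubC_eq0 // -['X - _]expr1 mup_XsubCX.
by rewrite addn0; case: eqP.
Qed.

End Eigenvalues.

(** * Determinants under reindexing and rank-one updates *)

Section Determinants.

(** Between ordinals of equal size an injection is a permutation; acting on both rows and columns,
    its sign occurs squared. The sizes are only propositionally equal, since [#|A| + #|B|] and
    [#|A :|: B|] are not convertible. *)
Lemma det_mxsub_inj (R : comNzRingType) n' n (f : 'I_n' -> 'I_n) (M : 'M[R]_n) :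
  n' = n -> injective f -> \det (mxsub f f M) = \det M.
Proof.
move=> eq_n; case: n / eq_n f M => f M f_inj.
have -> : mxsub f f M = row_perm (perm f_inj) (col_perm (perm f_inj) M).
  by apply/matrixP=> i j; rewrite !mxE !permE.
rewrite row_permE col_permE !det_mulmx !det_perm mulrCA.
by rewrite -signr_addb odd_permV addbb mulr1.
Qed.

Lemma char_poly_mxsub (R : comNzRingType) n' n (f : 'I_n' -> 'I_n)
  (M : 'M[R]_n) :
  n' = n -> injective f -> char_poly (mxsub f f M) = char_poly M.
Proof.
move=> eq_n f_inj; rewrite /char_poly -[RHS](det_mxsub_inj _ eq_n f_inj).
by congr (\det _); apply/matrixP=> i j; rewrite !mxE (inj_eq f_inj).
Qed.

(* Both sides are the bordered determinant det [A u; v 1], reduced by column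
   operations in two ways; this needs neither x nor det A to be invertible. *)
Lemma det_rank1_update (R : comNzRingType) n (A : 'M[R]_n) (u : 'cV_n)
    (v : 'rV_n) (x : R) : A *m u = x *: u ->
  x * \det (A - u *m v) = (x - (v *m u) 0 0) * \det A.
Proof.
move=> Au; pose B := block_mx A u v (1%:M : 'M_1).
have dB : \det B = \det (A - u *m v).
  have : B *m block_mx 1%:M 0 (- v) 1%:M = block_mx (A - u *m v) u 0 1%:M.
    by rewrite mulmx_block !mulmx1 !mulmx0 !mul1mx mulmxN addrN !add0r.
  move/(congr1 determinant).
  by rewrite det_mulmx det_lblock det_ublock !det1 !mulr1.
have : B *m block_mx 1%:M (- u) 0 x%:M =
       block_mx A 0 v (x%:M - v *m u).
  rewrite mulmx_block !mulmx1 !mulmx0 !mul1mx !mulmxN !addr0 Au mul_mx_scalar.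
  by rewrite addNr addrC.
move/(congr1 determinant); rewrite det_mulmx det_ublock det_lblock det1 mul1r dB.
by rewrite !det_mx11 !mxE eqxx mulr1n [LHS]mulrC => ->; rewrite mulrC.
Qed.

(** The all-ones matrix is a column of ones times a row of ones, and [char_poly_mx A] multiplies
    that column by ['X] because [A] kills it. *)
Lemma char_poly_addJ (R : comNzRingType) n (A : 'M[R]_n) :
  A *m const_mx 1 = 0 :> 'cV_n ->
  'X * char_poly (A + const_mx 1) = ('X - n%:R%:P) * char_poly A.
Proof.
move=> A1.
have := @det_rank1_update _ _ (char_poly_mx A) (const_mx 1) (const_mx 1) 'X.
have -> : char_poly_mx A - (const_mx 1 : 'cV_n) *m (const_mx 1 : 'rV_n) =
          char_poly_mx (A + const_mx 1).
  apply/matrixP=> i j; rewrite !mxE big_ord1 !mxE mulr1.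
  by rewrite [in RHS]polyCD opprD addrA.
have -> : ((const_mx 1 : 'rV_n) *m (const_mx 1 : 'cV_n) : 'M[{poly R}]_1) 0 0 = n%:R%:P.
  rewrite !mxE (eq_bigr (fun=> 1)) => [|k _]; last by rewrite !mxE mulr1.
  by rewrite sumr_const card_ord polyC_natr.
apply; rewrite /char_poly_mx mulmxBl mul_scalar_mx.
have -> : (const_mx 1 : 'cV[{poly R}]_n) = map_mx polyC (const_mx 1).
  by apply/matrixP=> i j; rewrite !mxE.
by rewrite -map_mxM A1 map_mx0 subr0.
Qed.

End Determinants.

(** * Matrices indexed by finite sets *)

Section SetMatrix.
Variables (S : finType) (R : comNzRingType).
Implicit Types (A B : {set S}) (K : S -> S -> R).

(** [K] lives on all of [S], so that kernels can be compared entrywise without casts between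
    dimensions. *)
Definition setmx A K : 'M[R]_#|A| :=
  \matrix_(a, b) K (enum_val a) (enum_val b).

Lemma eq_setmx A K K' : {in A &, K =2 K'} -> setmx A K = setmx A K'.
Proof. by move=> eqK; apply/matrixP=> a b; rewrite !mxE eqK ?enum_valP. Qed.

(** Listing [A] first and then [B] permutes rows and columns simultaneously, and in that order the
    matrix is block diagonal. *)
Lemma char_poly_setmxU A B K : [disjoint A & B] ->
  (forall F G, F \in A -> G \in B -> K F G = 0) ->
  (forall F G, F \in B -> G \in A -> K F G = 0) ->
  char_poly (setmx (A :|: B) K) =
    char_poly (setmx A K) * char_poly (setmx B K).
Proof.
move=> dAB KAB KBA.
pose g (i : 'I_(#|A| + #|B|)) : S :=
  match split i with inl j => enum_val j | inr j => enum_val j end.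
have gU i : g i \in A :|: B.
  by rewrite /g inE; case: split => j; rewrite enum_valP ?orbT.
pose f i := enum_rank_in (gU i) (g i).
have fK i : enum_val (f i) = g i by rewrite enum_rankK_in.
have f_inj : injective f.
  move=> i j /(congr1 enum_val); rewrite !fK /g => gij.
  apply: (can_inj splitK).
  case: (split i) gij => a; case: (split j) => b.
  - by move/enum_val_inj->.
  - by move=> ab; have := disjointFr dAB (enum_valP a); rewrite ab enum_valP.
  - by move=> ab; have := disjointFr dAB (enum_valP b); rewrite -ab enum_valP.
  - by move/enum_val_inj->.
have eq_n : (#|A| + #|B|)%N = #|A :|: B|.
  by rewrite cardsU disjoint_setI0 // cards0 subn0.
rewrite -(char_poly_mxsub _ eq_n f_inj).
have -> : mxsub f f (setmx (A :|: B) K) = block_mx (setmx A K) 0 0 (setmx B K).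
  apply/matrixP=> i j; rewrite !mxE !fK /g.
  case: (split i) => a; rewrite !mxE; case: (split j) => b; rewrite mxE //.
    by rewrite KAB ?enum_valP.
  by rewrite KBA ?enum_valP.
by rewrite /char_poly char_block_diag_mx det_ublock.
Qed.

Lemma char_poly_setmx0 A K :
  #|A| = 0 -> char_poly (setmx A K) = 1.
Proof.
by rewrite /char_poly => A0; move: (setmx A K); rewrite A0 => M; rewrite det_mx00.
Qed.

Lemma char_poly_setmx1 (a : S) K :
  char_poly (setmx [set a] K) = 'X - (K a a)%:P.
Proof.
have f_inj : injective (fun _ : 'I_1 => enum_rank_in (set11 a) a).
  by move=> i j _; rewrite (ord1 i) (ord1 j).
rewrite -(char_poly_mxsub _ (esym (cards1 a)) f_inj) /char_poly det_mx11 !mxE.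
by rewrite enum_rankK_in ?set11 // eqxx.
Qed.

End SetMatrix.

(** * The Laplacian as a kernel on faces, and incidence numbers *)

Section Faces.
Variables (T : finType) (R : comNzRingType).
Implicit Types (V W F G H : {set T}) (D E : {set {set T}}).

Definition card_faces D k := [set F in D | #|F| == k].

Lemma faces_card D (k : nat) : faces D (k%:Z - 1) = card_faces D k.
Proof.
by apply/setP=> F; rewrite !inE /dim (inj_eq (addIr _)) eqz_nat.
Qed.

Lemma faces_card_pred D (k : nat) :
  faces D (k%:Z - 1 - 1) = [set F in D | #|F|.+1 == k].
Proof.
apply/setP=> F; rewrite !inE /dim (inj_eq (addIr _)).
by rewrite eq_sym subr_eq eq_sym addrC -intS eqz_nat.
Qed.

(** Entries of $\partial\partial^*$ and $\partial^*\partial$ when [E] consists of the faces one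
    dimension above, respectively below. *)
Definition up E F G : R := \sum_(H in E) incidence R F H * incidence R G H.
Definition down E F G : R := \sum_(H in E) incidence R H F * incidence R H G.

(* Indexed by the cardinality k of a face, so this is L_(k-1); the condition
   #|F|.+1 == k avoids the junk value of k.-1 at k = 0. *)
Definition lap D k F G : R :=
  up (card_faces D k.+1) F G + down [set F in D | #|F|.+1 == k] F G.

Lemma char_poly_laplacian D (k : nat) :
  char_poly (laplacian R D (k%:Z - 1)) =
  char_poly (setmx (card_faces D k) (lap D k)).
Proof.
rewrite -faces_card; congr (char_poly _); apply/matrixP=> a b.
have k1 : k%:Z - 1 + 1 = k.+1%:Z - 1 by rewrite subrK intS addrC addKr.
rewrite !mxE /lap /up /down -faces_card -faces_card_pred k1.
by congr (_ + _); rewrite [RHS]big_enum_val; apply: eq_bigr => H _; rewrite !mxE.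
Qed.

Lemma incidence_eq0 F G : ~~ (F \subset G) -> incidence R F G = 0.
Proof.
move=> FG; apply: big_pred0 => v; apply/negP=> /andP[_ /eqP vF].
by rewrite -vF subD1set in FG.
Qed.

Lemma incidence_set0 H : #|H| = 1%N -> incidence R set0 H = 1.
Proof.
move/eqP/cards1P=> [v ->]; rewrite /incidence (big_pred1 v).
  rewrite (_ : [set _ in _ | _] = set0) ?cards0 //.
  by apply/setP=> w; rewrite !inE; case: eqP => // ->; rewrite ltnn.
move=> w; rewrite !inE /=; case: eqP => //= ->.
by apply/eqP/setP=> u; rewrite !inE andNb.
Qed.

(** The two endpoints of an edge carry opposite signs. Hence the graph Laplacian kills the all-ones
    vector. *)
Lemma sum_incidence_edge D H :
  (forall F G, F \in D -> G \subset F -> G \in D) ->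
  H \in card_faces D 2 -> \sum_(F in card_faces D 1) incidence R F H = 0.
Proof.
move=> Dsub; rewrite inE => /andP[HD H2].
pose s (v : T) : R := (-1) ^+ #|[set w in H | (enum_rank w < enum_rank v)%N]|.
transitivity (\sum_(v in H) s v).
  rewrite /incidence (exchange_big_dep (fun v => v \in H)) /=; last first.
    by move=> F v _ /andP[].
  apply: eq_bigr => v vH; rewrite (big_pred1 (H :\ v)) // => F.
  rewrite vH inE /= [F == _]eq_sym; case: (H :\ v =P F) => [<-|]; rewrite ?andbF // andbT.
  by move: H2; rewrite (cardsD1 v H) vH (Dsub H) ?subD1set.
case/cards2P: H2 => v [w] [vw eqH]; rewrite /s {s HD}eqH.
(* By symmetry [v] precedes [w], so the signs are $(-1)^0$ and $(-1)^1$. *)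
wlog vw_lt : v w vw / (enum_rank v < enum_rank w)%N => [wlog_lt|].
  have := vw; rewrite -(inj_eq enum_rank_inj) -(inj_eq val_inj) neq_ltn.
  by case/orP=> lt; [|rewrite setUC]; apply: wlog_lt => //; rewrite eq_sym.
rewrite big_setU1 ?inE //= big_set1.
rewrite (_ : [set _ in _ | _] = set0) ?cards0; last first.
  apply/setP=> u; rewrite !inE; case: eqP => [->|_] /=; first by rewrite ltnn.
  by case: eqP => [->|//] /=; rewrite ltnNge ltnW.
rewrite (_ : [set _ in _ | _] = [set v]) ?cards1 ?expr0 ?expr1 ?subrr //.
apply/setP=> u; rewrite !inE; case: eqP => [->|_] /=; first by rewrite vw_lt.
by case: eqP => [->|//] /=; rewrite ltnn.
Qed.

End Faces.

(** * Up and down parts for a union over disjoint vertex sets *)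

Section Union.
Variables (T : finType) (R : comNzRingType).
Implicit Types (V W F G H : {set T}) (D E : {set {set T}}).

Lemma face_notsub V W D E F G : [disjoint V & W] ->
  (forall F, F \in D -> F \subset V) -> (forall F, F \in E -> F \subset W) ->
  F \in D -> G \in E -> (0 < #|F|)%N -> ~~ (F \subset G).
Proof.
move=> dVW DV EW FD GE /card_gt0P[v vF]; apply/negP=> /subsetP/(_ v vF) vG.
have := disjointFr dVW (subsetP (DV F FD) v vF).
by rewrite (subsetP (EW G GE)).
Qed.

Section Sums.
Variables (V W : {set T}) (D E : {set {set T}}).
Hypothesis dVW : [disjoint V & W].
Hypotheses (DV : forall F, F \in D -> F \subset V)
           (EW : forall F, F \in E -> F \subset W).

Lemma sum_setU (f : {set T} -> R) :
  (forall H, H \in E -> H \notin D -> f H = 0) ->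
  \sum_(H in D :|: E) f H = \sum_(H in D) f H.
Proof.
move=> f0; rewrite [RHS]big_mkcond [LHS]big_mkcond; apply: eq_bigr => H _.
by rewrite inE; case: (boolP (H \in D)) => //= HD; case: ifPn => // HE; rewrite f0.
Qed.

(** No subset of [W] contains the non-empty [F], so [E] contributes nothing. *)
Lemma up_setUl F G : F \subset V -> (0 < #|F|)%N ->
  up R (D :|: E) F G = up R D F G.
Proof.
move=> FV F0; apply: sum_setU => H HE _; rewrite incidence_eq0 ?mul0r //.
(* The singleton [[set F]] serves as the family of subsets of [V]. *)
by apply: (@face_notsub V W [set F] E) => // [K|]; rewrite inE // => /eqP->.
Qed.

Lemma down_setUl F G : F \subset V -> (forall H, H \in E -> (0 < #|H|)%N) ->
  down R (D :|: E) F G = down R D F G.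
Proof.
move=> FV E0; apply: sum_setU => H HE _.
rewrite [incidence R H F]incidence_eq0 ?mul0r //.
apply: (@face_notsub W V E [set F]); rewrite ?inE ?E0 //.
  by rewrite disjoint_sym.
by move=> K; rewrite inE => /eqP->.
Qed.

Lemma up_cross F G : F \subset V -> G \subset W ->
  (0 < #|F|)%N -> (0 < #|G|)%N -> up R (D :|: E) F G = 0.
Proof.
move=> FV GW F0 G0; rewrite up_setUl // /up big1 // => H HD.
rewrite [incidence R G H]incidence_eq0 ?mulr0 //.
apply: (@face_notsub W V [set G] D); rewrite ?inE //.
  by rewrite disjoint_sym.
by move=> K; rewrite inE => /eqP->.
Qed.

(** A common facet would lie on both sides, hence be empty. The empty face is excluded: as a facet
    of every vertex it couples the two complexes in degree 0. *)
Lemma down_cross F G : F \subset V -> G \subset W ->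
  (forall H, H \in D :|: E -> (0 < #|H|)%N) -> down R (D :|: E) F G = 0.
Proof.
move=> FV GW DE0; rewrite down_setUl // => [|H HE]; last first.
  by rewrite DE0 // inE HE orbT.
rewrite /down big1 // => H HD.
rewrite [incidence R H G]incidence_eq0 ?mulr0 //.
apply: (@face_notsub V W D [set G]); rewrite ?inE //.
  by move=> K; rewrite inE => /eqP->.
by rewrite DE0 // inE HD.
Qed.

End Sums.

Lemma card_facesU D E k :
  card_faces (D :|: E) k = card_faces D k :|: card_faces E k.
Proof. by apply/setP=> F; rewrite !inE andb_orl. Qed.

Section Charpoly.
Variables (V W : {set T}) (D E : {set {set T}}).
Hypothesis dVW : [disjoint V & W].
Hypotheses (DV : forall F, F \in D -> F \subset V)
           (EW : forall F, F \in E -> F \subset W).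

Let card_DV k F : F \in card_faces D k -> F \subset V.
Proof. by rewrite inE => /andP[/DV]. Qed.
Let card_EW k F : F \in card_faces E k -> F \subset W.
Proof. by rewrite inE => /andP[/EW]. Qed.
Let card_gt0 X k F : F \in card_faces X k.+1 -> (0 < #|F|)%N.
Proof. by rewrite inE => /andP[_ /eqP->]. Qed.
Let dWV : [disjoint W & V]. Proof. by rewrite disjoint_sym. Qed.

Lemma card_faces_disjoint k :
  [disjoint card_faces D k.+1 & card_faces E k.+1].
Proof.
rewrite disjoints_subset; apply/subsetP=> F FD; rewrite in_setC; apply/negP=> FE.
by have /negP[] := face_notsub dVW (@card_DV k.+1) (@card_EW k.+1) FD FE (card_gt0 FD).
Qed.

(** The case [k = 0] is the splitting of the graph Laplacian, available although the full Laplacian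
    is coupled there. *)
Lemma char_poly_upU k :
  char_poly (setmx (card_faces (D :|: E) k.+1)
                   (up R (card_faces (D :|: E) k.+2))) =
  char_poly (setmx (card_faces D k.+1) (up R (card_faces D k.+2))) *
  char_poly (setmx (card_faces E k.+1) (up R (card_faces E k.+2))).
Proof.
rewrite !card_facesU char_poly_setmxU.
- congr (_ * _); congr (char_poly _); apply: eq_setmx => F G FX GX.
    by rewrite (up_setUl _ dVW (@card_EW _)) ?(card_DV FX) ?(card_gt0 FX).
  by rewrite setUC (up_setUl _ dWV (@card_DV _)) ?(card_EW FX) ?(card_gt0 FX).
- exact: card_faces_disjoint.
- move=> F G FX GX; apply: (up_cross dVW (@card_DV _) (@card_EW _));
    by [exact: card_DV FX | exact: card_EW GX | exact: card_gt0 FX | exact: card_gt0 GX].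
- move=> F G FX GX; rewrite setUC; apply: (up_cross dWV (@card_EW _) (@card_DV _));
    by [exact: card_EW FX | exact: card_DV GX | exact: card_gt0 FX | exact: card_gt0 GX].
Qed.

(** With index [k.+2] the lower faces have [k.+1] vertices, hence are non-empty, so the cross terms
    of the down part vanish too. *)
Lemma char_poly_lapU k :
  char_poly (setmx (card_faces (D :|: E) k.+2) (lap R (D :|: E) k.+2)) =
  char_poly (setmx (card_faces D k.+2) (lap R D k.+2)) *
  char_poly (setmx (card_faces E k.+2) (lap R E k.+2)).
Proof.
have predE (X : {set {set T}}) : [set F in X | #|F|.+1 == k.+2] = card_faces X k.+1.
  by apply/setP=> F; rewrite !inE.
rewrite /lap !predE !card_facesU char_poly_setmxU.
- congr (_ * _); congr (char_poly _); apply: eq_setmx => F G FX GX.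
    rewrite (up_setUl _ dVW (@card_EW _)) ?(card_DV FX) ?(card_gt0 FX) //.
    by rewrite (down_setUl _ dVW (@card_EW _)) ?(card_DV FX) // => H /card_gt0.
  rewrite ![card_faces D _ :|: _]setUC.
  rewrite (up_setUl _ dWV (@card_DV _)) ?(card_EW FX) ?(card_gt0 FX) //.
  by rewrite (down_setUl _ dWV (@card_DV _)) ?(card_EW FX) // => H /card_gt0.
- exact: card_faces_disjoint.
- move=> F G FX GX.
  rewrite (up_cross dVW (@card_DV _) (@card_EW _)) ?(card_DV FX) ?(card_EW GX)
          ?(card_gt0 FX) ?(card_gt0 GX) // add0r.
  rewrite (down_cross dVW (@card_DV _) (@card_EW _)) ?(card_DV FX) ?(card_EW GX) //.
  by move=> H; rewrite -card_facesU => /card_gt0.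
- move=> F G FX GX; rewrite ![card_faces D _ :|: _]setUC.
  rewrite (up_cross dWV (@card_EW _) (@card_DV _)) ?(card_EW FX) ?(card_DV GX)
          ?(card_gt0 FX) ?(card_gt0 GX) // add0r.
  rewrite (down_cross dWV (@card_EW _) (@card_DV _)) ?(card_EW FX) ?(card_DV GX) //.
  by move=> H; rewrite -card_facesU => /card_gt0.
Qed.

End Charpoly.

(** * Degrees -1 and 0 of a single complex *)

Section OneComplex.
Variable D : {set {set T}}.
Hypothesis Dsub : forall F G, F \in D -> G \subset F -> G \in D.
Hypothesis D0 : D != set0.

Let set0D : set0 \in D.
Proof. by case/set0Pn: D0 => F FD; apply: Dsub FD (sub0set F). Qed.

Lemma card_faces0 : card_faces D 0 = [set set0].
Proof.
apply/setP=> F; rewrite !inE cards_eq0; case: eqP => [->|_]; rewrite ?andbF //.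
by rewrite set0D.
Qed.

Lemma char_poly_lap0 :
  char_poly (setmx (card_faces D 0) (lap R D 0)) =
  'X - #|card_faces D 1|%:R%:P.
Proof.
rewrite card_faces0 char_poly_setmx1 /lap /down big_pred0 ?addr0.
  rewrite /up (eq_bigr (fun=> 1)) ?sumr_const // => H; rewrite inE.
  by case/andP=> _ /eqP H1; rewrite incidence_set0 // mulr1.
by move=> F; rewrite inE andbF.
Qed.

(** The only facet of a vertex is the empty face, with coefficient 1, so the down part is the
    all-ones matrix. *)
Lemma char_poly_lap1 :
  'X * char_poly (setmx (card_faces D 1) (lap R D 1)) =
  ('X - #|card_faces D 1|%:R%:P) *
  char_poly (setmx (card_faces D 1) (up R (card_faces D 2))).
Proof.
rewrite -char_poly_addJ.
  congr ('X * char_poly _); apply/matrixP=> a b; rewrite !mxE /lap; congr (_ + _).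
  have a1 := enum_valP a; have b1 := enum_valP b; move: a1 b1; rewrite !inE.
  move=> /andP[_ /eqP a1] /andP[_ /eqP b1].
  rewrite /down (big_pred1 set0) ?incidence_set0 ?mulr1 // => F.
  by have /setP/(_ F) := card_faces0; rewrite !inE.
apply/matrixP=> a j; rewrite !mxE.
under eq_bigr do rewrite !mxE mulr1.
(* The side condition of [char_poly_addJ]: after exchanging sums, each edge contributes a multiple
   of its vanishing incidence sum. *)
rewrite -(big_enum_val (fun F => up R _ (enum_val a) F)) exchange_big /=.
by apply: big1 => H H2; rewrite -mulr_sumr sum_incidence_edge ?mulr0.
Qed.

End OneComplex.

End Union.

(** * Coefficients of the spectrum polynomial and the union formula *)

Lemma coef_spectrum_poly (R : rcfType) (T : finType) (D : {set {set T}}) k :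
  (spectrum_poly R D)`_k =
  \sum_(x <- roots_mult (char_poly (setmx (card_faces D k) (lap R D k)))) qpow x.
Proof.
rewrite coef_poly -char_poly_laplacian; case: ifPn => //; rewrite -leqNgt => kT.
(* Beyond the truncation there are no faces, and the empty matrix has characteristic polynomial 1,
   without roots. *)
rewrite char_poly_laplacian char_poly_setmx0 ?roots_mult1 ?big_nil //.
apply/eqP; rewrite cards_eq0; apply/eqP/setP=> F; rewrite !inE.
by apply/negP=> /andP[_ /eqP Fk]; rewrite -Fk ltnNge max_card in kT.
Qed.

Theorem lemma6p9 (R : realType) (T : finType) (V W : {set T})
    (Delta Gamma : {set {set T}}) (n m : nat)
    (hVW : [disjoint V & W])
    (hDelta : simplicial_complex V Delta)
    (hGamma : simplicial_complex W Gamma)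
    (Delta_neq0 : Delta != set0) (Gamma_neq0 : Gamma != set0)
    (hn : n = f_num Delta 0) (hm : m = f_num Gamma 0) :
  spectrum_poly R (Delta :|: Gamma) =
    spectrum_poly R Delta + spectrum_poly R Gamma
    + (1 + 'X) * (qpow (n + m)%:R - (qpow n%:R + qpow m%:R))%:P + 'X.
Proof.
have [[DV Dsub] [GW Gsub]] := (hDelta, hGamma).
have {}hn : #|card_faces Delta 1| = n by rewrite hn /f_num -(faces_card _ 1) subrr.
have {}hm : #|card_faces Gamma 1| = m by rewrite hm /f_num -(faces_card _ 1) subrr.
have Usub (F G : {set T}) : F \in Delta :|: Gamma -> G \subset F -> G \in Delta :|: Gamma.
  rewrite !inE => /orP[FX|FX] GF; first by rewrite (Dsub F).
  by rewrite (Gsub F) ?orbT.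
have U_neq0 : Delta :|: Gamma != set0.
  by apply: contra Delta_neq0; rewrite setU_eq0 => /andP[].
have hU : #|card_faces (Delta :|: Gamma) 1| = (n + m)%N.
  by rewrite card_facesU cardsU disjoint_setI0 ?(card_faces_disjoint hVW) //
             cards0 subn0 hn hm.
pose chi (D : {set {set T}}) k : {poly R} := char_poly (setmx (card_faces D k) (lap R D k)).
have chi_neq0 D k : chi D k != 0 by rewrite monic_neq0 ?char_poly_monic.
(* The generating function of the roots, turning products into sums. *)
pose Q (p : {poly R}) := \sum_(x <- roots_mult p) qpow x.
have QM p q : p != 0 -> q != 0 -> Q (p * q) = Q p + Q q.
  by move=> p0 q0; rewrite /Q (perm_big _ (roots_multM p0 q0)) big_cat.
have QXsubC c : Q ('X - c%:P) = qpow c by rewrite /Q roots_mult_XsubC big_seq1.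
have coefQ D k : (spectrum_poly R D)`_k = Q (chi D k) by exact: coef_spectrum_poly.
(* The root 0 contributes $q^0=1$, the source of the final term $t$. *)
have QX : Q 'X = 1.
  rewrite -['X]subr0 -[0]polyC0 QXsubC -[RHS]/(<< exponent0 R >>) /qpow.
  by congr (<< _ >>); apply: val_inj; rewrite val_insubd lexx.
set q := qpow (n + m)%:R - _.
apply/polyP=> k; rewrite !coefD mulrDl mul1r coefD coefMC coefC !coefX !coefQ.
(* With [q] the bracket, the correction $(1+t)q+t$ has coefficients $q$, $q+1$ and 0 in degrees 0, 1
   and at least 2. *)
case: k => [|[|k]] /=.
- rewrite /chi !char_poly_lap0 // hU hn hm !QXsubC mul0r !addr0 /q.
  by rewrite addrC subrK.
- have chi1 : chi (Delta :|: Gamma) 1%N * (('X - n%:R%:P) * ('X - m%:R%:P)) =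
              ('X - (n + m)%:R%:P) * (chi Delta 1%N * chi Gamma 1%N) * 'X.
    have X0 : 'X != 0 :> {poly R} by rewrite polyX_eq0.
    (* The extra ['X] lets all three identities apply: one factor on the left for the union, two on
       the right for the two complexes. *)
    apply: (mulfI X0).
    have eD : 'X * chi Delta 1%N = _ := char_poly_lap1 R Dsub Delta_neq0.
    have eG : 'X * chi Gamma 1%N = _ := char_poly_lap1 R Gsub Gamma_neq0.
    have eU : 'X * chi (Delta :|: Gamma) 1%N = _ := char_poly_lap1 R Usub U_neq0.
    rewrite (char_poly_upU R hVW) // [X in X%:R]hU in eU.
    rewrite [X in X%:R]hn in eD; rewrite [X in X%:R]hm in eG.
    rewrite mulrA eU -[LHS]mulrA [X in _ * X = _]mulrC [X in _ * X = _]mulrACA -eD -eG.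
    rewrite [X in _ * X = _]mulrACA -[X in _ = _ * X]mulrA [RHS]mulrCA.
    by rewrite -['X * 'X * _]mulrA [X in _ * (_ * X) = _]mulrC.
  have := congr1 Q chi1.
  rewrite !QM ?mulf_neq0 ?polyXsubC_eq0 ?polyX_eq0 // !QXsubC QX.
  move/(canRL (addrK _)) ->; rewrite /q mul1r add0r.
  by rewrite addrAC [_ + _ - _]addrAC [X in X + 1]addrC.
- rewrite mul0r !addr0 /chi (char_poly_lapU R hVW) // QM //; exact: chi_neq0.
Qed.
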